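(* Let $X$ be the Cantor set and let $G\leq\mathrm{Homeo}(X)$ be uniformly discrete. Then the piecewise full group $\mathbf{F}(G)$ is ample.
   Context: For $G\le \mathrm{Homeo}(X)$, the piecewise full group $\mathbf{F}(G)$ consists of all $g\in\mathrm{Homeo}(X)$ for which there are a finite clopen partition $X=U_1\sqcup\dots\sqcup U_n$ and $g_1,\dots,g_n\in G$ with $g|_{U_i}=g_i|_{U_i}$; $G$ is piecewise full if $\mathbf{F}(G)=G$. $G$ is ample if it is piecewise full, locally finite (every finite subset lies in a finite subgroup), countable, and for every $g\in G$ the set $\mathrm{Fix}(g)$ of fixed points is clopen in $X$. $G$ is uniformly discrete if there is a (finite) clopen partition $\mathcal{P}$ of $X$ with $|Gx\cap U|\le1$ for all $x\in X$ and $U\in\mathcal{P}$. *)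

(* Defs.v *)
From HB Require Import structures.
From mathcomp Require Import all_boot.
From mathcomp Require Import boolp classical_sets functions cardinality.
From mathcomp Require Import topology cantor.

Set Implicit Arguments.
Unset Strict Implicit.
Unset Printing Implicit Defensive.

Local Open Scope group_scope.
Local Open Scope classical_set_scope.

Definition homeomorphism (X Y : topologicalType) (f : X -> Y) : Prop :=
  continuous f /\
  exists g : Y -> X, [/\ continuous g, cancel f g & cancel g f].

Record homeo (X : topologicalType) := Homeo {
  homeo_fun :> X -> X;
  homeoP : homeomorphism homeo_fun
}.

HB.instance Definition _ (X : topologicalType) := gen_eqMixin (homeo X).
HB.instance Definition _ (X : topologicalType) := gen_choiceMixin (homeo X).

Section HomeoGroup.
Variable X : topologicalType.
Implicit Types f g h : homeo X.

Lemma homeo_eqP f g : f =1 g -> f = g.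
Proof.
case: f g => [f Hf] [g Hg] /= /funext fg.
by case: _ / fg Hg => Hg; rewrite (Prop_irrelevance Hf Hg).
Qed.

Lemma homeomorphism_id : homeomorphism (@id X).
Proof. by split; [|exists id; split] => // x. Qed.

Lemma homeomorphism_comp f g : homeomorphism (f \o g).
Proof.
have [fc [f' [f'c fK f'K]]] := homeoP f.
have [gc [g' [g'c gK g'K]]] := homeoP g.
split; first by move=> x; apply: continuous_comp; [exact: gc|exact: fc].
exists (g' \o f'); split.
- by move=> x; apply: continuous_comp; [exact: f'c|exact: g'c].
- exact: can_comp.
- exact: can_comp.
Qed.

Definition homeo_inv_fun f : X -> X := projT1 (cid (proj2 (homeoP f))).

Lemma homeo_funK f : cancel f (homeo_inv_fun f).
Proof. by rewrite /homeo_inv_fun; case: cid => g []. Qed.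

Lemma homeo_inv_funK f : cancel (homeo_inv_fun f) f.
Proof. by rewrite /homeo_inv_fun; case: cid => g []. Qed.

Lemma homeomorphism_inv f : homeomorphism (homeo_inv_fun f).
Proof.
split; first by rewrite /homeo_inv_fun; case: cid => g [].
exists f; split; last exact: homeo_funK.
- by case: (homeoP f).
- exact: homeo_inv_funK.
Qed.

Definition homeo_one : homeo X := Homeo homeomorphism_id.
Definition homeo_mul f g : homeo X := Homeo (homeomorphism_comp f g).
Definition homeo_inv f : homeo X := Homeo (homeomorphism_inv f).

Lemma homeo_mulA : associative homeo_mul.
Proof. by move=> f g h; exact: homeo_eqP. Qed.

Lemma homeo_mul1 : left_id homeo_one homeo_mul.
Proof. by move=> f; exact: homeo_eqP. Qed.

Lemma homeo_mulr1 : right_id homeo_one homeo_mul.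
Proof. by move=> f; exact: homeo_eqP. Qed.

Lemma homeo_mulV : left_inverse homeo_one homeo_inv homeo_mul.
Proof. by move=> f; apply: homeo_eqP => x; exact: homeo_funK. Qed.

Lemma homeo_mulrV : right_inverse homeo_one homeo_inv homeo_mul.
Proof. by move=> f; apply: homeo_eqP => x; exact: homeo_inv_funK. Qed.

End HomeoGroup.

(* The product is composition: (f * g) x = f (g x). *)
HB.instance Definition _ (X : topologicalType) :=
  isGroup.Build (homeo X)
    (@homeo_mulA X) (@homeo_mul1 X) (@homeo_mulr1 X)
    (@homeo_mulV X) (@homeo_mulrV X).

Definition is_subgroup (T : groupType) (G : set T) : Prop :=
  group_closed [in G].

Definition locally_finite_group (T : groupType) (G : set T) : Prop :=
  forall A : set T, finite_set A -> A `<=` G ->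
    exists H : set T, [/\ is_subgroup H, finite_set H, A `<=` H & H `<=` G].

Section FullGroups.
Variable X : topologicalType.
Implicit Types (G : set (homeo X)) (P : set (set X)).

Definition finite_clopen_partition P : Prop :=
  [/\ finite_set P, partition P id [set: X] & P `<=` @clopen X].

Definition piecewise_full_group G : set (homeo X) :=
  [set g | exists2 P, finite_clopen_partition P &
    forall U, P U -> exists2 h, G h & forall x, U x -> g x = h x].

Definition piecewise_full G : Prop := piecewise_full_group G = G.

Definition Fix (g : homeo X) : set X := [set x | g x = x].

Definition ample G : Prop :=
  [/\ is_subgroup G, piecewise_full G, locally_finite_group G, countable G &
      forall g, G g -> clopen (Fix g)].

Definition homeo_orbit G (x : X) : set X := [set g x | g in G].

Definition uniformly_discrete G : Prop :=
  exists2 P, finite_clopen_partition P &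
    forall x U, P U -> is_subset1 (homeo_orbit G x `&` U).

End FullGroups.

(* Main.v *)
(* Uniform discreteness amounts to a locally constant colouring c of X with
finitely many colours that is injective on every orbit.  By compactness, being
piecewise in G is a local condition, so F(G) is a subgroup, F is idempotent,
and F(G) has the same orbits as G; hence c is injective on the orbits of F(G)
too.  An element g of F(G) is thus determined by the map c o g, i.e. by
finitely many clopen sets, of which there are only countably many, and
Fix(g) = {x | c (g x) = c x} is clopen.  For local finiteness, give x the code
consisting of its colour and of the way the finitely many given elements act on
the (coloured) orbit of x.  There are finitely many codes, the given elements
permute the classes of points with equal codes, and an element permuting these
classes is determined by its action on them. *)
Require Import Defs.
From mathcomp Require Import all_boot finmap.
From mathcomp Require Import boolp classical_sets functions cardinality.
From mathcomp Require Import topology cantor.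

Set Implicit Arguments.
Unset Strict Implicit.
Unset Printing Implicit Defensive.

Local Open Scope classical_set_scope.

(** * Locally constant maps and clopen partitions *)

Definition locally_constant (X : topologicalType) (T : Type) (f : X -> T) :=
  forall x, \forall y \near x, f y = f x.

Lemma locally_constant_clopen (X : topologicalType) (T : Type) (f : X -> T)
  (A : set T) : locally_constant f -> clopen (f @^-1` A).
Proof.
move=> fl; have op B : open (f @^-1` B).
  rewrite openE => x /= Bx; rewrite /interior.
  by apply: filterS (fl x) => y /= ->.
by split=> //; rewrite -[X in closed X]setCK; apply/open_closedC/(op (~` A)).
Qed.

Lemma clopen_nbhs (X : topologicalType) (U : set X) (x : X) :
  clopen U -> U x -> nbhs x U.
Proof. by move=> [oU _] Ux; apply: open_nbhs_nbhs. Qed.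

Lemma locally_constant_mem (X : topologicalType) (U : set X) :
  clopen U -> locally_constant U.
Proof.
move=> cU x; have [Ux|Ux] := pselect (U x).
  by apply: (filterS _ (clopen_nbhs cU Ux)) => y Uy; rewrite propeqE.
by apply: (filterS _ (clopen_nbhs (clopenC U cU) Ux)) => y Uy; rewrite propeqE.
Qed.

Section Partitions.
Variable X : topologicalType.

Lemma fibers_clopen_partition (T : finType) (f : X -> T) :
  locally_constant f ->
  finite_clopen_partition [set f @^-1` [set f x] | x in [set: X]].
Proof.
move=> fl; split.
- apply: (@sub_finite_set _ _ [set f @^-1` [set t] | t in [set: T]]).
    by move=> _ [x _ <-]; exists (f x).
  exact: finite_image.
- split.
  + rewrite eqEsubset; split => // x _.
    by exists (f @^-1` [set f x]) => //; exists x.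
  + by move=> _ _ [x _ <-] [y _ <-] [z [/= <- <-]].
  + by move=> _ [x _ <-]; exists x.
- by move=> _ [x _ <-]; apply: locally_constant_clopen.
Qed.

Lemma clopen_partition_coloring (P : set (set X)) :
  finite_clopen_partition P ->
  exists n (c : X -> 'I_n), locally_constant c /\
    forall x y, c x = c y -> exists U, [/\ P U, U x & U y].
Proof.
move=> [Pfin [Pcov Ptriv _] Pclo].
have blockP x : exists U, P U /\ U x.
  by have : [set: X] x by []; rewrite -Pcov => -[U PU Ux]; exists U.
pose block x := projT1 (cid (blockP x)).
have Pblock x : P (block x) by rewrite /block; case: cid => U [].
have blockx x : block x x by rewrite /block; case: cid => U [].
(* The colour of a point is the position of its block in an enumeration [s] of [P]. *)
have [s sP] := (finite_seqP P).1 Pfin.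
have block_s x : (index (block x) s < size s)%N.
  by rewrite index_mem; have := Pblock x; rewrite sP.
exists (size s), (fun x => Ordinal (block_s x)); split=> [x|x y [exy]].
  have := clopen_nbhs (Pclo _ (Pblock x)) (blockx x).
  apply: filterS => y yx; apply: val_inj => /=; congr index.
  by apply: Ptriv => //; exists y.
exists (block x); split => //.
suff -> : block x = block y by [].
by rewrite -(nth_index set0 (s := s) (x := block x)) -?index_mem// exy nth_index
  -?index_mem.
Qed.

End Partitions.

(** * Piecewise membership as a local condition *)

Section PiecewiseFull.
Variable X : ptopologicalType.
Hypothesis cX : compact [set: X].
Hypothesis hX : hausdorff_space X.
Hypothesis zX : zero_dimensional X.
Implicit Type G : set (homeo X).

(** From right to left, zero-dimensionality shrinks the neighbourhoods to clopen ones and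
    compactness leaves finitely many; these may overlap, so they are refined to a partition. *)
Lemma piecewise_full_groupP G g : piecewise_full_group G g <->
  forall x : X, exists2 h, G h & \forall y \near x, g y = h y.
Proof.
split=> [[P [_ [Pcov _ _] Pclo] Pg] x|loc].
  have : [set: X] x by []; rewrite -Pcov => -[U PU Ux].
  have [h Gh gh] := Pg _ PU; exists h => //.
  exact: filterS gh (clopen_nbhs (Pclo _ PU) Ux).
have loc_clopen x : exists Uh : set X * homeo X,
    [/\ clopen Uh.1, Uh.1 x, G Uh.2 & forall y, Uh.1 y -> g y = Uh.2 y].
  have [h Gh gh] := loc x.
  have [U [Ux Uclo] Ugh] := zero_dimensional_cvg hX zX cX gh.
  by exists (U, h).
pose U x := (projT1 (cid (loc_clopen x))).1.
have Uclo x : clopen (U x) by rewrite /U; case: cid => ? [].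
have Ux x : U x x by rewrite /U; case: cid => ? [].
have gU x : exists2 h, G h & forall y, U x y -> g y = h y.
  by rewrite /U; case: cid => -[V h] [] /= *; exists h.
have [D _ Dcov] : finite_subset_cover [set: X] U [set: X].
  move: (cX); rewrite compact_cover; apply; first by move=> x _; case: (Uclo x).
  by move=> x _; exists x.
(* [f x] records which members of the finite subcover contain [x]. Its fibres are the atoms of the
   Boolean algebra they generate, so each lies inside some member. *)
pose f (x : X) : {ffun D -> bool} := [ffun d => `[< U (val d) x >]].
exists [set f @^-1` [set f x] | x in [set: X]].
  apply: fibers_clopen_partition => x.
  have fd d : \forall y \near x, f y d = f x d.
    have := locally_constant_mem (Uclo (val d)).
    by move=> /(_ x); apply: filterS => y yx; rewrite !ffunE yx.
  have := filter_forall (nbhs_filter x) fd.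
  by apply: filterS => y yx; apply/ffunP.
move=> _ [x _ <-]; have [d dD Udx] := Dcov x I.
have [h Gh gh] := gU d; exists h => // y /= fyx; apply: gh.
have /ffunP/(_ [` dD]%fset) := fyx; rewrite !ffunE => e.
exact: (asbool_eq_equiv e).2.
Qed.

Lemma piecewise_full_group_pointwise G g : piecewise_full_group G g ->
  forall x : X, exists2 h, G h & g x = h x.
Proof.
move=> /piecewise_full_groupP Fg x.
by have [h Gh /nbhs_singleton gh] := Fg x; exists h.
Qed.

Lemma sub_piecewise_full_group G : G `<=` piecewise_full_group G.
Proof.
by move=> g Gg; apply/piecewise_full_groupP => x; exists g => //; apply: nearW.
Qed.

Lemma piecewise_full_groupK G : piecewise_full (piecewise_full_group G).
Proof.
rewrite /piecewise_full eqEsubset; split; last exact: sub_piecewise_full_group.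
move=> g /piecewise_full_groupP Fg; apply/piecewise_full_groupP => x.
have [h /piecewise_full_groupP/(_ x) [k Gk hk] gh] := Fg x; exists k => //.
by apply: filterS2 gh hk => y -> ->.
Qed.

Lemma is_subgroup_piecewise_full_group G :
  is_subgroup G -> is_subgroup (piecewise_full_group G).
Proof.
move=> [/set_mem G1 GV]; split=> [|u v /set_mem + /set_mem].
  exact/mem_set/sub_piecewise_full_group.
move=> /piecewise_full_groupP Fu /piecewise_full_groupP Fv.
(* Both local pieces are taken at [z], and continuity of [v^-1] carries the agreement back to a
   neighbourhood of [x]. *)
apply/mem_set/piecewise_full_groupP => x; set z := (v^-1)%g x.
have [h Gh uh] := Fu z; have [k Gk vk] := Fv z.
exists (h / k)%g; first by apply/set_mem/GV; exact: mem_set.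
have vc : {for x, continuous (v^-1)%g} by case: (homeoP (v^-1)%g) => + _; apply.
have uv : \forall y \near x, u ((v^-1)%g y) = h ((v^-1)%g y) /\
    v ((v^-1)%g y) = k ((v^-1)%g y) by exact: vc _ (filterI uh vk).
apply: (filterS _ uv) => y /= [uvy vky].
rewrite -[LHS]/(u ((v^-1)%g y)) uvy -[RHS]/(h ((k^-1)%g y)); congr (h _).
(* [v] and [k] agree at [v^-1 y], so [k] sends both [v^-1 y] and [k^-1 y] to [y]. *)
apply: (can_inj (homeo_funK k)); rewrite -vky.
by rewrite -[LHS]/((v * v^-1)%g y) -[RHS]/((k * k^-1)%g y) !mulgV.
Qed.

End PiecewiseFull.

(** * Groups whose orbits are separated by a finite colouring *)

Definition separates_orbits (X : topologicalType) (T : Type)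
    (H : set (homeo X)) (c : X -> T) :=
  forall g h x, H g -> H h -> c (g x) = c (h x) -> g x = h x.

Section SeparatedOrbits.
Variables (X : topologicalType) (T : finType) (H : set (homeo X)) (c : X -> T).
Hypothesis Hgroup : is_subgroup H.
Hypothesis Hc : separates_orbits H c.

Let H1 : H 1%g. Proof. by apply/set_mem/Hgroup.1. Qed.

Let HM g h : H g -> H h -> H (g * h)%g.
Proof.
by move=> Hg Hh; apply/set_mem/(group_closedM Hgroup); exact: mem_set.
Qed.

Let HB g h : H g -> H h -> H (g / h)%g.
Proof. by move=> Hg Hh; apply/set_mem/Hgroup.2; exact: mem_set. Qed.

Lemma separated_locally_finite : locally_finite_group H.
Proof.
move=> A /finite_seqP [s As] AH.
pose act (i : 'I_(size s)) := nth 1%g s i.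
have actH i : H (act i) by apply: AH; rewrite As; exact: mem_nth.
(* The second component is the edge set of the Schreier graph of the orbit of [x], with vertices
   named by their colours; it depends only on the orbit. *)
pose code x : T * {ffun T * 'I_(size s) * T -> bool} :=
  (c x, [ffun p => `[< exists2 h, H h &
                       c (h x) = p.1.1 /\ c (act p.1.2 (h x)) = p.2 >]]).
have code2 g x : H g -> (code (g x)).2 = (code x).2.
  move=> Hg; apply/ffunP => p; rewrite !ffunE; apply/asbool_equiv_eq.
  split=> -[h Hh hp]; first by exists (h * g)%g => //; exact: HM.
  exists (h / g)%g; first exact: HB.
  by rewrite -[(h / g)%g (g x)]/((h / g * g)%g x) divgK.
have codeE x y : c x = c y -> (code x).2 = (code y).2 -> code x = code y.
  by rewrite /code /= => -> ->.
(* The edge leaving [x] under [act i] also occurs in the orbit of [y], starting at some [h y]. Equal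
   colours at either end of the edge force [h y = y]. *)
have actE i x y : (code x).2 = (code y).2 ->
    c x = c y <-> c (act i x) = c (act i y).
  move=> /ffunP exy; have := exy (c x, i, c (act i x)); rewrite !ffunE /= => e.
  have [|h Hh [hy ahy]] := (asbool_eq_equiv e).1; first by exists 1%g.
  split=> [cxy|caxy].
    by rewrite -ahy (@Hc h 1%g y) // hy.
  suff /= <- : h y = y by rewrite hy.
  apply: (can_inj (homeo_funK (act i))).
  rewrite -[LHS]/((act i * h)%g y).
  by apply: Hc; [exact: HM|exact: actH|rewrite /= ahy].
(* Closure under inverses is built into [K] by the equivalence. *)
pose K := [set g | H g /\
  forall x y, code x = code y <-> code (g x) = code (g y)].
have Kgroup : is_subgroup K.
  split=> [|u v /set_mem [Hu Ku] /set_mem [Hv Kv]]; first exact/mem_set.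
  apply/mem_set; split=> [|x y]; first exact: HB.
  have vVK z : v ((v^-1)%g z) = z.
    by rewrite -[LHS]/((v * v^-1)%g z) mulgV.
  apply: iff_trans (Ku _ _); apply: iff_sym.
  by have := Kv ((v^-1)%g x) ((v^-1)%g y); rewrite !vVK.
exists K; split=> //; last by move=> g [].
  pose graph (g : homeo X) :
      {ffun (T * {ffun T * 'I_(size s) * T -> bool}) * T -> bool} :=
    [ffun q => `[< exists x, code x = q.1 /\ c (g x) = q.2 >]].
  (* Equal graphs give a [y] with the code of [x] and [c (h y) = c (g x)]. As [h] respects codes,
     [c (h x) = c (h y)], and separation yields [g x = h x]. *)
  have graph_inj : {in K &, injective graph}.
    move=> g h /set_mem [Hg Kg] /set_mem [Hh Kh] /ffunP gh.
    apply: homeo_eqP => x; apply: Hc => //.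
    have := gh (code x, c (g x)); rewrite !ffunE /= => e.
    have [|y [/Kh [hxy _] <-]] := (asbool_eq_equiv e).1; first by exists x.
    by case: hxy.
  by rewrite -(eq_finite_set (inj_card_eq graph_inj)).
move=> a Aa; split=> [|x y]; first exact: AH.
have Ha := AH _ Aa; move: Aa; rewrite As => /(nthP 1%g) [i si ai].
set j := Ordinal si; have {ai} -> : a = act j by rewrite -ai.
(* The second components are orbit invariants, so only colours remain to be compared, by [actE]. *)
split=> e.
  have e2 : (code x).2 = (code y).2 by rewrite e.
  apply: codeE; last by rewrite !code2.
  by apply/(actE j x y e2); case: e.
have e2 : (code x).2 = (code y).2.
  by rewrite -(code2 (act j) x) // -(code2 (act j) y) // e.
by apply: codeE => //; apply/(actE j x y e2); case: e.
Qed.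

Lemma separated_countable : locally_constant c -> countable (@clopen X) ->
  countable H.
Proof.
move=> cl /countable_injP [e einj]; apply/countable_injP.
pose code (g : homeo X) : {ffun T -> nat} :=
  [ffun t => e ((c \o g) @^-1` [set t])].
exists (choice.pickle \o code) => g h /set_mem Hg /set_mem Hh.
move=> /(pcan_inj choice.pickleK) /ffunP gh.
apply: homeo_eqP => x; apply: Hc => //.
have clo (k : homeo X) t : clopen ((c \o k) @^-1` [set t]).
  rewrite comp_preimage; apply: preimage_clopen; last by case: (homeoP k).
  exact: locally_constant_clopen.
(* For the colour [c (g x)], the preimage under [c \o g] contains [x], hence so does the one under
   [c \o h]. *)
have := gh (c (g x)); rewrite !ffunE.
move=> /einj; rewrite !inE => /(_ (clo _ _) (clo _ _)) /seteqP[/(_ x) + _].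
by move=> /(_ erefl) /= ->.
Qed.

Lemma separated_Fix_clopen g : locally_constant c -> H g -> clopen (Fix g).
Proof.
move=> cl Hg; have gc : continuous g by case: (homeoP g).
have -> : Fix g = (fun x => (c (g x), c x)) @^-1` [set p | p.1 = p.2].
  rewrite eqEsubset; split=> x /=; rewrite /Fix /=; first by move->.
  exact: (Hc Hg H1).
apply: locally_constant_clopen => x.
have := gc x _ (cl (g x)); apply: filterS2 (cl x) => y /= -> ->.
by [].
Qed.

End SeparatedOrbits.

(** * Uniform discreteness and the Cantor space *)

Lemma uniformly_discrete_coloring (X : topologicalType) (G : set (homeo X)) :
  uniformly_discrete G ->
  exists n (c : X -> 'I_n), locally_constant c /\ separates_orbits G c.
Proof.
move=> [P /clopen_partition_coloring [n [c [cl cP]]] PG].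
exists n, c; split=> // g h x Gg Gh /cP [U [PU Ug Uh]].
by apply: (PG x U PU); split=> //; [exists g|exists h].
Qed.

(** The cylinders over finite binary words form a countable base. *)
Lemma cantor_space_second_countable : @second_countable cantor_space.
Proof.
pose cyl (s : seq bool) : set cantor_space :=
  [set x : cantor_space | forall i : 'I_(size s), x i = nth false s i].
have cyl_open s : open (cyl s).
  rewrite openE => x sx.
  suff : \forall y \near x, forall i : 'I_(size s),
    (y : cantor_space) i = nth false s i by [].
  apply: (filter_forall (nbhs_filter x)) => i.
  have pxi : \forall y \near x, [set x (i : nat)] ((y : cantor_space) i).
    exact: @proj_continuous nat (fun=> bool) i x _ (discrete_set1 (x i)).
  by apply: (filterS _ pxi) => y /= ->; exact: sx.
exists (range cyl);
  first exact: card_le_trans (card_image_le _ _) (countableP _).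
split=> [_ [s _ <-] //|x].
have prefix_cyl n y : cyl (mkseq x n) y <-> forall i, (i < n)%N -> y i = x i.
  split=> [yx i ilt|yx i].
    have ilt' : (i < size (mkseq x n))%N by rewrite size_mkseq.
    by rewrite (yx (Ordinal ilt')) nth_mkseq.
  have ilt : (i < n)%N by rewrite -[ltnRHS](size_mkseq x) ltn_ord.
  by rewrite nth_mkseq // yx.
have xcyl n : cyl (mkseq x n) x by apply/prefix_cyl.
have F : Filter (filter_from [set n : nat | True] (fun n => cyl (mkseq x n))).
  apply: filter_from_filter; first by exists 0.
  move=> m n _ _; exists (maxn m n) => // y /prefix_cyl yx.
  by split; apply/prefix_cyl => i ilt; apply: yx; rewrite leq_max ilt ?orbT.
suff cyl_cvg : filter_from [set n : nat | True]
    (fun n => cyl (mkseq x n)) --> x.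
  move=> U /cyl_cvg [n _ nU]; exists (cyl (mkseq x n)).
    by split; [exists (mkseq x n)|exact: xcyl].
  exact: nU.
(* The product topology is the supremum of the coordinate topologies, so one coordinate [i] is
   treated at a time; a prefix of length [i.+1] already fixes it. *)
apply/cvg_sup => i U [B [[W oW <-] Wx WU]].
exists i.+1 => // y /prefix_cyl yx; apply: WU => /=.
by rewrite yx.
Qed.

Theorem proposition2p8 (G : set (homeo cantor_space)) :
  is_subgroup G -> uniformly_discrete G -> ample (piecewise_full_group G).
Proof.
move=> Ggroup /uniformly_discrete_coloring [n [c [cl cG]]].
have cX := cantor_space_compact; have hX := cantor_space_hausdorff.
have zX := cantor_zero_dimensional.
have Fgroup := is_subgroup_piecewise_full_group cX hX zX Ggroup.
(* At the given point [x], both elements can be replaced by elements of [G]. *)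
have Fc : separates_orbits (piecewise_full_group G) c.
  move=> g h x /(piecewise_full_group_pointwise cX hX zX) /(_ x) [g' Gg' ->].
  move=> /(piecewise_full_group_pointwise cX hX zX) /(_ x) [h' Gh' ->].
  exact: cG.
split=> //.
- exact: piecewise_full_groupK.
- exact: separated_locally_finite Fgroup Fc.
- apply: separated_countable Fc cl _.
  exact: clopen_countable cX cantor_space_second_countable.
- by move=> g; apply: separated_Fix_clopen Fgroup Fc _ cl.
Qed.
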